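(* Let $X$ be a reflexive real Banach space and $A:X\rightrightarrows X^*$ a maximal monotone operator such that $\operatorname{int}(D(A))\neq\emptyset$. Let $D$ be a dense subset of $D(A)$ and let $\tilde A$ be a selection of $A$. Then, for every $x\in X$, $$Ax=\overline{\operatorname{co}}\left\{\bigcup_{v\in\operatorname{int}(D(A))-x}\ w\text{-}\operatorname{Limsup}_{\substack{w\to v,\ t\downarrow0\\ x+tw\in D}}\tilde A(x+tw)\right\}+N(x;\overline{D(A)})$$ and $$Ax=\overline{\operatorname{co}}\left\{w\text{-}\operatorname{Limsup}_{y\overset{D}{\to}x}\tilde Ay\right\}+N(x;\overline{D(A)}).$$
   Context: $X^*$ is the continuous dual of $X$, $\langle\cdot,\cdot\rangle$ the duality pairing, $\to$ norm convergence and $\rightharpoonup$ weak convergence; interior, closure and density refer to the norm topology, and $\overline{\operatorname{co}}$ denotes the closed convex hull. For a set-valued operator $A:X\rightrightarrows X^*$, $D(A)=\{x\in X: Ax\neq\emptyset\}$. $A$ is monotone if $\langle x^*-y^*,x-y\rangle\ge 0$ whenever $x^*\in Ax$, $y^*\in Ay$, and maximal monotone if in addition its graph is not properly contained in the graph of another monotone operator. For such $A$ the set $\overline{D(A)}$ is convex. A selection of $A$ is a single-valued map $\tilde A:D(A)\to X^*$ with $\tilde A(y)\in Ay$ for all $y\in D(A)$. ''$D$ is a dense subset of $D(A)$'' means $D\subset D(A)\subset\overline{D}$. $w\text{-}\operatorname{Limsup}_{w\to v,\,t\downarrow0,\,x+tw\in D}\tilde A(x+tw)$ is the set of all $x^*\in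 X^*$ for which there exist sequences $w_n\to v$ in $X$ and $t_n\downarrow0$ (with $t_n>0$) such that $x+t_nw_n\in D$ for all $n\in\mathbb{N}$ and $\tilde A(x+t_nw_n)\rightharpoonup x^*$. $w\text{-}\operatorname{Limsup}_{y\overset{D}{\to}x}\tilde Ay$ is the set of all $x^*\in X^*$ for which there exists a sequence $y_n\to x$ with $y_n\in D$ for all $n\in\mathbb{N}$ and $\tilde A y_n\rightharpoonup x^*$. For a nonempty closed convex $S\subset X$ and $x\in S$, the normal cone is $N(x;S)=\{x^*\in X^*:\sup_{y\in S}\langle x^*,y-x\rangle\le0\}$; for $x\notin S$ put $N(x;S)=\emptyset$. The sum of any set with the empty set is empty, and $\overline{\operatorname{co}}\,\emptyset=\emptyset$. *)

(* Defs.v *)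
From HB Require Import structures.
From mathcomp Require Import all_boot all_order all_algebra.
From mathcomp Require Import all_classical all_reals all_analysis.

Set Implicit Arguments.
Unset Strict Implicit.
Unset Printing Implicit Defensive.

Import Order.TTheory GRing.Theory Num.Theory.
Import numFieldNormedType.Exports.

Local Open Scope classical_set_scope.
Local Open Scope ring_scope.

Section dual_space.
Context {R : realType} (X : normedModType R).

Definition dual_pred : {pred X -> R^o} :=
  fun f => `[< linear f /\ continuous f >].

Record dual := Dual { dual_fun :> X -> R^o ; _ : dual_fun \in dual_pred }.

HB.instance Definition _ := [isSub for dual_fun].
HB.instance Definition _ := [Choice of dual by <:].

Lemma dual_submod_closed : submod_closed dual_pred.
Proof.
split.
  apply/asboolP; split; last by move=> x; exact: cst_continuous.
  by move=> a x y; rewrite /= scaler0 addr0.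
move=> a f g /asboolP[lf cf] /asboolP[lg cg]; apply/asboolP; split.
  move=> b x y; change (a *: f (b *: x + y) + g (b *: x + y) =
    b *: (a *: f x + g x) + (a *: f y + g y)).
  rewrite lf lg !scalerDr !scalerA (mulrC a b) -!addrA.
  by congr (_ + _); rewrite addrCA.
move=> x; change ((fun y => a *: f y + g y) @ x --> a *: f x + g x).
by apply: cvgD; [apply: cvgZl_tmp; exact: cf | exact: cg].
Qed.

HB.instance Definition _ :=
  GRing.isSubmodClosed.Build R (X -> R^o) dual_pred dual_submod_closed.
HB.instance Definition _ := [SubChoice_isSubLmodule of dual by <:].

Lemma dual_linear (f : dual) : linear f.
Proof. by have /asboolP[] := valP f. Qed.

Lemma dual_continuous (f : dual) : continuous f.
Proof. by have /asboolP[] := valP f. Qed.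

HB.instance Definition _ (f : dual) :=
  GRing.isLinear.Build R X R^o *:%R f (dual_linear f).

Lemma dualP (f g : dual) : f =1 g -> f = g.
Proof. by move=> fg; apply/val_inj/funext. Qed.

Definition dual_norm (f : dual) : R := sup [set `|f x| | x in [set x | `|x| <= 1]].

Lemma dual_has_sup (f : dual) :
  has_sup [set `|f x| | x in [set x | `|x| <= 1]].
Proof.
split; first by exists `|f 0|; exists 0 => //=; rewrite normr0.
have /bounded_funP/(_ 1)[M hM] : bounded_near f (nbhs (0 : X)).
  exact/linear_bounded_continuous/dual_continuous.
by exists M => _ [x x1 <-]; exact: hM.
Qed.

Lemma dual_norm_ub (f : dual) x : `|f x| <= dual_norm f * `|x|.
Proof.
have [->|x0] := eqVneq x 0; first by rewrite linear0 !normr0 mulr0.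
have nx0 : 0 < `|x| by rewrite normr_gt0.
rewrite -ler_pdivrMr//.
have -> : `|f x| / `|x| = `|f (`|x|^-1 *: x)|.
  by rewrite linearZ/= normrZ gtr0_norm ?invr_gt0// mulrC.
apply: sup_upper_bound; first exact: dual_has_sup.
exists (`|x|^-1 *: x) => //=.
by rewrite normrZ gtr0_norm ?invr_gt0// mulVf// gt_eqF.
Qed.

Lemma dual_norm_le (f : dual) c :
  0 <= c -> (forall x, `|f x| <= c * `|x|) -> dual_norm f <= c.
Proof.
move=> c0 fc; apply: ge_sup; first by case: (dual_has_sup f).
by move=> _ [x /= x1 <-]; rewrite (le_trans (fc x))// ler_piMr.
Qed.

Lemma dual_norm_ge0 (f : dual) : 0 <= dual_norm f.
Proof.
apply: le_trans (normr_ge0 (f 0)) _; apply: sup_upper_bound.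
  exact: dual_has_sup.
by exists 0 => //=; rewrite normr0.
Qed.

Lemma dual_normD (f g : dual) :
  dual_norm (f + g) <= dual_norm f + dual_norm g.
Proof.
apply: dual_norm_le; first by rewrite addr_ge0 ?dual_norm_ge0.
move=> x; rewrite mulrDl (le_trans (ler_normD (f x) (g x)))//.
by rewrite lerD ?dual_norm_ub.
Qed.

Let dual_normZ_le a (f : dual) : dual_norm (a *: f) <= `|a| * dual_norm f.
Proof.
apply: dual_norm_le; first by rewrite mulr_ge0 ?dual_norm_ge0.
move=> x; change (`|a *: f x| <= `|a| * dual_norm f * `|x|).
by rewrite normrZ -mulrA ler_wpM2l// dual_norm_ub.
Qed.

Lemma dual_normZ a (f : dual) : dual_norm (a *: f) = `|a| * dual_norm f.
Proof.
apply/eqP; rewrite eq_le dual_normZ_le/=.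
have [->|a0] := eqVneq a 0; first by rewrite normr0 mul0r dual_norm_ge0.
rewrite -ler_pdivlMl ?normr_gt0// -normfV.
by rewrite -{1}[f](scalerK a0) dual_normZ_le.
Qed.

Lemma dual_norm_eq0 (f : dual) : dual_norm f = 0 -> f = 0.
Proof.
move=> f0; apply: dualP => x; apply/eqP; rewrite -normr_le0.
by rewrite (le_trans (dual_norm_ub f x))// f0 mul0r.
Qed.

HB.instance Definition _ := Lmodule_isNormed.Build R dual
  dual_normD dual_normZ dual_norm_eq0.

End dual_space.

Section reflexivity.
Context {R : realType} (X : normedModType R).

Lemma bidual_subproof (x : X) :
  ((fun f : dual X => f x) : dual X -> R^o) \in @dual_pred R (dual X).
Proof.
have lx : linear ((fun f : dual X => f x) : dual X -> R^o) by [].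
apply/asboolP; split=> //.
pose L := GRing.isLinear.Build R (dual X) R^o *:%R _ lx.
pose e : {linear dual X -> R^o} := HB.pack (fun f : dual X => f x : R^o) L.
apply: (@bounded_linear_continuous _ _ _ e).
apply/bounded_funP => r; exists (r * `|x|) => f fr.
by rewrite (le_trans (dual_norm_ub f x))// ler_wpM2r.
Qed.

Definition bidual (x : X) : dual (dual X) := Dual (bidual_subproof x).

Definition reflexive_space := forall phi : dual (dual X), exists x, bidual x = phi.

End reflexivity.

Section convergence_and_convexity.
Context {R : realType} {Y : normedModType R}.

Definition weak_cvg (u : nat -> Y) (l : Y) :=
  forall phi : dual Y, phi (u n) @[n --> \oo] --> phi l.

Definition closed_convex_hull (C : set Y) : set Y :=
  smallest [set K : set Y | closed K /\ convex_set K] C.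

Definition set_add (S T : set Y) : set Y := [set a + b | a in S & b in T].

End convergence_and_convexity.

Section monotone_operators.
Context {R : realType} {X : normedModType R}.
Implicit Types (A : X -> set (dual X)) (At : X -> dual X) (D S : set X).

Definition op_dom A : set X := [set x | A x !=set0].

Definition op_graph A : set (X * dual X) := [set p | A p.1 p.2].

Definition monotone_op A := forall (x y : X) (xs ys : dual X),
  A x xs -> A y ys -> 0 <= (xs - ys) (x - y).

Definition maximal_monotone A := monotone_op A /\
  forall B : X -> set (dual X), monotone_op B -> ~ (op_graph A `<` op_graph B).

(* The map is total, but only its values on [op_dom A] are constrained. *)
Definition selection A At := forall y, op_dom A y -> A y (At y).

Definition dense_subset D S := D `<=` S /\ S `<=` closure D.

Definition wLimsup_dir At D (x v : X) : set (dual X) :=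
  [set xs | exists (w : nat -> X) (t : nat -> R),
    [/\ w n @[n --> \oo] --> v,
        t n @[n --> \oo] --> (0 : R),
        forall n, 0 < t n,
        forall n, D (x + t n *: w n) &
        weak_cvg (fun n => At (x + t n *: w n)) xs]].

Definition wLimsup At D (x : X) : set (dual X) :=
  [set xs | exists y : nat -> X,
    [/\ y n @[n --> \oo] --> x,
        forall n, D (y n) &
        weak_cvg (fun n => At (y n)) xs]].

Definition normal_cone (x : X) S : set (dual X) :=
  [set xs | S x /\ (ereal_sup [set (xs (y - x))%:E | y in S] <= 0)%E].

End monotone_operators.

(* Main.v *)
Require Import Defs.
From HB Require Import structures.
From mathcomp Require Import all_boot all_order all_algebra.
From mathcomp Require Import all_classical all_reals all_analysis.
From mathcomp Require Import ring lra.
Import Order.TTheory GRing.Theory Num.Theory.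
Import numFieldNormedType.Exports.
Local Open Scope classical_set_scope.
Local Open Scope ring_scope.

Set Implicit Arguments.
Unset Strict Implicit.
Unset Printing Implicit Defensive.

(** Write [V] for the set of directions [v] such that [x + v] is interior to the
    domain of [A], and [M] for the set of weak directional limits at [x].
    Limits of selections belong to [A x] because [A] is maximal monotone, and
    [A x] is closed, convex and stable under adding normal vectors; this gives
    one inclusion.  For the other one, fix [xs] in [A x].  The values of [A] stay
    bounded along [x + t w], [w] near [v], so that weak sequential compactness
    yields, for every [v] in [V], a limit [m] in [M] with [xs v <= m v].  Hence
    the sublinear functional [d |-> inf_(c in cone V) sup_(m in M) (m (d + c) - xs c)]
    is finite, and a linear functional [f] below it satisfies both [f <= sup M],
    i.e., [f] is in the closed convex hull of [M] by reflexivity and Mazur's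
    theorem, and [xs <= f] on [V], i.e., [xs - f] is normal.  The density of the
    interior in the domain and its convexity come from the same Hahn-Banach
    argument, applied to the monotone extension problem at a point of a segment
    joining a point of the domain to an interior one. *)

(** * The Hahn-Banach theorem by conic epigraphs *)

Section hahn_banach.
Context {R : realType} (X : lmodType R).

(* [E] stands for the epigraph of a sublinear functional. *)
Definition conic (E : set (X * R)) := [/\
  forall d d' k k', E (d, k) -> E (d', k') -> E (d + d', k + k'),
  forall s d k, 0 < s -> E (d, k) -> E (s *: d, s * k) &
  forall k, E (0, k) -> 0 <= k].

(* Zorn's lemma on epigraphs rather than on partial functionals: a maximal one
   is a half-space. *)
Lemma maximal_conic (E0 : set (X * R)) : conic E0 -> E0 (0, 0) ->
  exists G, [/\ conic G, E0 `<=` G &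
    forall d k, G (d, k) \/ exists2 k', k' < - k & G (- d, k')].
Proof.
move=> [E0D E0Z E0p] E00.
(* Only [E0] joined with [A] is required to be conic, so that the empty chain is admissible too. *)
have [|A [cA Amax]] := @Zorn_bigcup _ [set A | conic (E0 `|` A)].
  move=> F FP Ftot.
  have pick1 p : (E0 `|` \bigcup_(A in F) A) p ->
      E0 p \/ exists2 A, F A & (E0 `|` A) p.
    by move=> [|[A FA Ap]]; [left|right; exists A => //; right].
  split.
  - move=> d d' k k' /pick1[Ep|[A FA Ap]] /pick1[Ep'|[A' FA' Ap']].
    + by left; exact: E0D.
    + have [+ _ _] := FP _ FA'.
      move=> /(_ d d' k k')[||E|A2]; [by left|by []|by left|].
      by right; exists A'.
    + have [+ _ _] := FP _ FA.
      move=> /(_ d d' k k')[||E|A2]; [by []|by left|by left|].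
      by right; exists A.
    + have [AA'|AA'] := Ftot _ _ FA FA'.
        have [+ _ _] := FP _ FA'; move=> /(_ d d' k k')[||E|A2] //.
        - by case: Ap => [|/AA']; [left|right].
        - by left.
        - by right; exists A'.
      have [+ _ _] := FP _ FA; move=> /(_ d d' k k')[||E|A2] //.
      - by case: Ap' => [|/AA']; [left|right].
      - by left.
      - by right; exists A.
  - move=> s d k s0 /pick1[Ep|[A FA Ap]]; first by left; exact: E0Z.
    have [_ + _] := FP _ FA; move=> /(_ s d k s0 Ap)[|A2]; first by left.
    by right; exists A.
  - move=> k /pick1[/E0p//|[A FA Ap]].
    by have [_ _ ] := FP _ FA; apply.
set G := E0 `|` A in cA; have [GD GZ Gp] := cA.
have G0 : G (0, 0) by left.
exists G; split => // [p|d k]; first by left.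
have [|nG] := pselect (G (d, k)); [by left|right].
(* [B] is the cone generated by [G] and the ray through [(d, k)]. By maximality it is not conic, and
   only the third condition can fail: [B] has a point of negative height above [0]. *)
pose B := [set p : X * R | exists p0 s,
  [/\ G p0, 0 <= s & p = (p0.1 + s *: d, p0.2 + s * k)]].
have GB : G `<=` B.
  move=> [a b] Gab; exists (a, b), 0; split => //=.
  by rewrite scale0r mul0r !addr0.
have EB : E0 `|` B = B.
  by apply/seteqP; split => [p [Ep|//]|p]; [apply: GB; left|right].
have ltAB : A `<` B.
  split; first by move=> p Ap; apply: GB; right.
  move=> /(_ (d, k)) BA; apply: nG; right; apply: BA.
  by exists (0, 0), 1; split => //=; rewrite scale1r mul1r !add0r.
have := Amax _ ltAB; rewrite /= EB => nB.
have [b [b0 Bb]] : exists b, b < 0 /\ B (0, b).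
  apply: contrapT => nb; apply: nB; split.
  - move=> d1 d2 k1 k2 [[a1 b1] [s1 [G1 s10 [-> ->]]]] [[a2 b2] [s2 [G2 s20 [-> ->]]]].
    exists (a1 + a2, b1 + b2), (s1 + s2); split => /=; first exact: GD.
      exact: addr_ge0.
    by rewrite scalerDl mulrDl; congr (_, _); rewrite addrACA.
  - move=> s d1 k1 s0 [[a1 b1] [s1 [G1 s10 [-> ->]]]].
    exists (s *: a1, s * b1), (s * s1); split => /=; first exact: GZ.
      by rewrite mulr_ge0// ltW.
    by rewrite scalerDr mulrDr scalerA mulrA.
  - by move=> b Bb; rewrite leNgt; apply/negP => b0; apply: nb; exists b.
move: Bb => [[a1 b1] [s [G1 s0 [/= /esym a1E bE]]]].
have {s0} sp : 0 < s.
  rewrite lt_def s0 andbT; apply/eqP => s00; move: a1E bE.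
  rewrite s00 scale0r mul0r !addr0 => a10 bE; rewrite a10 -bE in G1.
  by have := Gp _ G1; rewrite leNgt b0.
exists (s^-1 * b1).
  rewrite -[ltRHS](mulKf (lt0r_neq0 sp)) ltr_pM2l ?invr_gt0//.
  by rewrite mulrN -subr_lt0 opprK -bE.
have {}a1E : a1 = - (s *: d) by apply/eqP; rewrite -addr_eq0 a1E.
have := @GZ s^-1 _ _ _ G1; rewrite invr_gt0 => /(_ sp).
by rewrite a1E scalerN scalerK ?lt0r_neq0.
Qed.

(** The lower boundary [P] of a maximal cone [G] is sublinear. The alternative satisfied by [G]
    makes it odd as well, hence linear. *)
Lemma hahn_banach_conic (E : set (X * R)) : conic E -> E (0, 0) ->
  (forall d, exists k, E (d, k)) ->
  exists f : {linear X -> R^o}, forall d k, E (d, k) -> f d <= k.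
Proof.
move=> cE E0 Eex; have [G [[GD GZ Gp] EG Gmax]] := maximal_conic cE E0.
pose S d := [set k | G (d, k)]; pose P d : R^o := inf (S d).
have Sne d : S d !=set0 by have [k /EG] := Eex d; exists k.
have Slb d k k' : G (- d, k') -> G (d, k) -> - k' <= k.
  by move=> G1 G2; have := GD _ _ _ _ G1 G2; rewrite addNr => /Gp; lra.
have Slb' d : has_lbound (S d).
  by have [k' Gk'] := Sne (- d); exists (- k') => k; exact: Slb.
have Pub d k : G (d, k) -> P d <= k by move=> Gdk; exact: ge_inf.
have Plb d x : (forall k, G (d, k) -> x <= k) -> x <= P d.
  by move=> h; apply: lb_le_inf => // k; exact: h.
have PN d : P (- d) = - P d.
  apply/le_anti/andP; split; last first.
    by apply: (Plb) => k' G'; rewrite lerNl; apply: Plb => k; exact: Slb.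
  (* A gap between [- P (- d)] and [P d] would contain a height [m] that violates both branches of
     the alternative at [(d, m)]. *)
  rewrite leNgt; apply/negP; rewrite ltrNl => /midf_lt[].
  set m := (_ / _) => m1 m2.
  have [/Pub|[k' k'm /Pub]] := Gmax d m; first by rewrite leNgt m2.
  by move=> /le_lt_trans/(_ k'm); rewrite ltrNr ltNge ltW.
have PD a b : P (a + b) <= P a + P b.
  rewrite -lerBlDr; apply: (Plb) => k Gk; rewrite lerBlDl -lerBlDr.
  apply: Plb => k' Gk'; rewrite lerBlDl; apply: Pub.
  exact: GD.
have PDE a b : P (a + b) = P a + P b.
  apply/le_anti; rewrite PD/= -lerN2 -PN !opprD -!PN.
  exact: PD.
have PZp s a : 0 < s -> P (s *: a) = s * P a.
  have le s' a' : 0 < s' -> s' * P a' <= P (s' *: a').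
    move=> s0; apply: Plb => k Gk; rewrite -ler_pdivlMl//; apply: Pub.
    have := @GZ s'^-1 _ _ _ Gk; rewrite invr_gt0 => /(_ s0).
    by rewrite scalerK ?lt0r_neq0.
  move=> s0; apply/le_anti; rewrite le// andbT.
  rewrite -ler_pdivrMl//; have := le s^-1 (s *: a); rewrite invr_gt0 => /(_ s0).
  by rewrite scalerK ?lt0r_neq0.
have P0 : P 0 = 0 by apply: (@addrI _ (P 0)); rewrite -PDE !addr0.
have lP : linear P.
  move=> s a b; rewrite PDE; congr (_ + _).
  have [s0|s0|->] := ltgtP s 0; last by rewrite !scale0r P0.
    have := PZp (- s) a; rewrite oppr_gt0 => /(_ s0).
    by rewrite scaleNr PN mulNr => /oppr_inj.
  exact: PZp.
pose L := GRing.isLinear.Build R X R^o *:%R P lP.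
exists (HB.pack P L : {linear X -> R^o}) => d k /EG; exact: Pub.
Qed.

End hahn_banach.

(** * Elementary estimates in the dual space *)

Section dual_extra.
Context {R : realType} {X : normedModType R}.
Implicit Types (f g : dual X).

Lemma dual_of_bounded (f : {linear X -> R^o}) (c : R) :
  (forall x, f x <= c * `|x|) -> exists2 g : dual X, g =1 f & `|g| <= `|c|.
Proof.
move=> fc.
have fc' x : `|f x| <= c * `|x|.
  rewrite ler_norml fc andbT lerNl -linearN.
  by rewrite (le_trans (fc _))// normrN.
have cf : continuous f.
  apply: bounded_linear_continuous.
  apply/bounded_funP => r; exists (`|c| * `|r|) => x xr.
  rewrite (le_trans (fc' x))// (le_trans (ler_norm _))// normrM ler_wpM2l//.
  by rewrite normr_id (le_trans xr) ?ler_norm.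
have df : (f : X -> R^o) \in @dual_pred R X.
  by apply/asboolP; split => //; exact: linearP.
exists (Dual df) => //.
apply: dual_norm_le => // x /=.
by rewrite (le_trans (fc' x))// ler_wpM2r// ler_norm.
Qed.

Lemma dualD f g x : (f + g) x = f x + g x. Proof. by []. Qed.
Lemma dualN f x : (- f) x = - f x. Proof. by []. Qed.
Lemma dualB f g x : (f - g) x = f x - g x. Proof. by []. Qed.
Lemma dualZ (a : R) f x : (a *: f) x = a * f x. Proof. by []. Qed.

Lemma dual_ub f x : `|f x| <= `|f| * `|x|. Proof. exact: dual_norm_ub. Qed.

Lemma dual_le f x : f x <= `|f| * `|x|.
Proof. exact: le_trans (ler_norm _) (dual_ub f x). Qed.

Lemma dual_ge f x : - (`|f| * `|x|) <= f x.
Proof. by rewrite lerNl (le_trans _ (dual_ub f x))// -normrN ler_norm. Qed.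

Lemma dual_norm_leP f (c : R) : 0 <= c ->
  (forall u, `|u| <= 1 -> f u <= c) -> `|f| <= c.
Proof.
move=> c0 fc; apply: dual_norm_le => // x.
have [->|x0] := eqVneq x 0; first by rewrite linear0 !normr0 mulr0.
have nx : 0 < `|x| by rewrite normr_gt0.
have h y : `|y| = `|x| -> f y <= c * `|x|.
  move=> yx; rewrite -ler_pdivrMr// mulrC.
  have -> : `|x|^-1 * f y = f (`|x|^-1 *: y) by rewrite linearZ.
  by apply: fc; rewrite normrZ gtr0_norm ?invr_gt0// yx mulVf ?gt_eqF.
by rewrite ler_norml h// andbT lerNl -linearN h// normrN.
Qed.

End dual_extra.

(** * Separation of a point from a closed convex set *)

Section mazur.
Context {R : realType} {Y : normedModType R}.

Lemma convex_setP (C : set Y) : convex_set C <->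
  forall x y s, 0 <= s -> s <= 1 -> C x -> C y -> C (s *: x + (1 - s) *: y).
Proof.
split=> [cC x y s s0 s1 Cx Cy|cC x y l].
  have s01 : Itv.spec (@Itv.num_sem R) (Itv.Real `[0%Z, 1%Z]) s.
    by apply/and3P; split; rewrite ?num_real//= in_itv/= s0 s1.
  have := @cC x y (Itv.mk s01); rewrite !inE; exact.
by rewrite !inE => Cx Cy; apply: cC.
Qed.

(** Hahn-Banach is applied to the infimum over [s >= 0] and [c] in [C] of [|d - s (c - f)| - s e],
    where [e] bounds the distance from [f] to [C] from below, so that the value at [0] is
    nonnegative. Taking [s = 0] bounds the functional by the norm; taking [s = 1] and [d = c - f]
    gives the gap [e]. *)
Lemma mazur_separation (C : set Y) (f : Y) : closed C -> convex_set C ->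
  C !=set0 -> ~ C f ->
  exists (phi : dual Y) (e : R), 0 < e /\ forall c, C c -> phi c <= phi f - e.
Proof.
move=> clC /convex_setP cC [c0 Cc0] nCf.
have [e e0 Ce] : exists2 e : R, 0 < e & forall c, C c -> e <= `|c - f|.
  have : nbhs f (~` C) by apply: open_nbhs_nbhs; split => //; exact: closed_openC.
  move=> /nbhs_normP[e /= e0 he]; exists e => // c Cc.
  rewrite leNgt; apply/negP => ce; apply: (he c) => //=.
  by rewrite distrC.
pose E := [set p : Y * R | exists s c,
  [/\ 0 <= s, C c & `|p.1 - s *: (c - f)| - s * e <= p.2]].
have [||d|phi hphi] := @hahn_banach_conic _ Y E.
- split.
  + move=> d d' k k' [s [c [s0 Cc h]]] [s' [c' [s0' Cc' h']]].
    rewrite /= in h h'.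
    (* The convex weights below divide by [s + s']; when it vanishes, any point of [C] will do. *)
    have [ss0|ssN0] := eqVneq (s + s') 0.
      have s00 : s = 0 by apply/le_anti; rewrite s0 andbT -ss0 lerDl.
      have s00' : s' = 0 by rewrite -ss0 s00 add0r.
      exists 0, c; split => //=; rewrite scale0r mul0r !subr0.
      move: h h'; rewrite s00 s00' !scale0r !mul0r !subr0 => h h'.
      by rewrite (le_trans (ler_normD _ _))// lerD.
    have ssp : 0 < s + s' by rewrite lt_def ssN0 addr_ge0.
    exists (s + s'), ((s / (s + s')) *: c + (1 - s / (s + s')) *: c').
    have q : 1 - s / (s + s') = s' / (s + s') by field.
    split; first exact: addr_ge0.
      apply: cC => //; first by rewrite divr_ge0// ltW.
      by rewrite ler_pdivrMr// mul1r lerDl.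
    rewrite /= q.
    have -> : (s + s') *: ((s / (s + s')) *: c + (s' / (s + s')) *: c' - f) =
        s *: (c - f) + s' *: (c' - f).
      rewrite !scalerBr scalerDr !scalerA ![(s + s') * (_ / _)]mulrC !divfK//.
      by rewrite scalerDl opprD addrACA.
    rewrite mulrDl !opprD addrACA.
    rewrite (le_trans (lerD (ler_normD _ _) (lexx _)))//.
    by rewrite addrACA lerD.
  + move=> s d k s0 [s' [c [s0' Cc /= h]]].
    exists (s * s'), c; split => //=; first by rewrite mulr_ge0// ltW.
    rewrite -scalerA -scalerBr normrZ gtr0_norm// -mulrA -mulrBr.
    by rewrite ler_pM2l.
  + move=> k [s [c [s0 Cc /=]]]; rewrite sub0r normrN normrZ ger0_norm//.
    by apply: le_trans; rewrite -mulrBr mulr_ge0// subr_ge0 Ce.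
- by exists 0, c0; split => //=; rewrite scale0r mul0r !subr0 normr0.
- by exists `|d|, 0, c0; split => //=; rewrite scale0r mul0r !subr0.
have [x|g gE _] := @dual_of_bounded _ _ phi 1.
  rewrite mul1r; apply: hphi.
  by exists 0, c0; split => //=; rewrite scale0r mul0r !subr0.
exists g, e; split => // c Cc.
have : phi (c - f) <= - e.
  apply: hphi; exists 1, c; split => //=.
  by rewrite scale1r subrr normr0 mul1r sub0r.
by rewrite !gE linearB lerBlDr addrC.
Qed.

End mazur.

(** * Norm neighbourhoods, subsequences and ultrafilters *)

Lemma closure_normP {R : realType} {Y : normedModType R} (S : set Y) (x : Y) :
  closure S x <-> forall e : R, 0 < e -> exists2 y, S y & `|x - y| < e.
Proof.
split=> [cS e e0|h B /nbhs_normP[e /= e0 eB]].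
  have [|y [Sy xy]] := cS [set y | `|x - y| < e].
    by apply/nbhs_normP; exists e.
  by exists y.
by have [y Sy xy] := h e e0; exists y; split => //; exact: eB.
Qed.

Lemma interior_normP {R : realType} {Y : normedModType R} (S : set Y) (x : Y) :
  interior S x <-> exists2 r : R, 0 < r & forall u, `|u| <= r -> S (x + u).
Proof.
split=> [/nbhs_normP[e /= e0 eS]|[r r0 rS]].
  exists (e / 2); first by rewrite divr_gt0.
  move=> u ue; apply: eS => /=; rewrite opprD addNKr normrN (le_lt_trans ue)//.
  by rewrite ltr_pdivrMr// ltr_pMr// ltr1n.
apply/nbhs_normP; exists r => //= y /= xy.
by rewrite -(subrKC x y); apply: rS; rewrite distrC ltW.
Qed.

(** Using the hypothesis with [N = k] gives [phi k >= k]. Monotonicity of [phi] is not asked for: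
    limits along [\oo] compose without it. *)
Lemma subseq_extract (P : nat -> nat -> Prop) :
  (forall k N, exists2 n, (N <= n)%N & P k n) ->
  exists2 phi : nat -> nat, phi n @[n --> \oo] --> \oo & forall k, P k (phi k).
Proof.
move=> h.
have /choice[pk hpk] : forall kN : nat * nat, exists n, (kN.2 <= n)%N /\ P kN.1 n.
  by move=> [k N]; have [n ? ?] := h k N; exists n.
exists (fun k => pk (k, k)); last by move=> k; have [] := hpk (k, k).
move=> A [N _ NA]; exists N => // k /= Nk; apply: NA => /=.
by apply: leq_trans Nk _; have [] := hpk (k, k).
Qed.

Lemma ultra_fmap {T U : Type} (a : T -> U) (F : set_system T) :
  UltraFilter F -> UltraFilter (a @ F).
Proof.
move=> FU; split=> [|G GG FG]; first exact: fmap_proper_filter.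
apply/seteqP; split=> // A GA.
have [//|nA] := in_ultra_setVsetC (a @^-1` A) FU.
have /FG GnA : (a @ F) (~` A) by [].
have : G (A `&` ~` A) by exact: filterI.
by rewrite setICr => /filter_not_empty.
Qed.

(** If the preimage of a neighbourhood were not in [F], then [F] restricted to its complement would
    be proper and would extend to an ultrafilter avoiding that preimage. *)
Lemma cvg_ultra {T : Type} {U : topologicalType} (a : T -> U) (F : set_system T)
    (l : U) : Filter F ->
  (forall G, UltraFilter G -> F `<=` G -> a @ G --> l) -> a @ F --> l.
Proof.
move=> FF h A Al; apply: contrapT => nA.
have pG : ProperFilter (within (~` (a @^-1` A)) F).
  apply: Build_ProperFilter; rewrite /within => H.
  by apply: nA; apply: (@filterS _ F _ _ _ _ H) => x /= nx; apply: contrapT => /nx.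
have [G [GU FG]] := ultraFilterLemma pG.
have : F `<=` G.
  by move=> B FB; apply: FG; apply: (@filterS _ F _ _ _ _ FB) => x.
move=> /(h _ GU)/(_ _ Al) GA.
have GnA : G (~` (a @^-1` A)) by apply: FG; apply: (@filterE _ F).
have : G ((a @^-1` A) `&` ~` (a @^-1` A)) by exact: filterI.
by rewrite setICr => /filter_not_empty.
Qed.

(** * Weak sequential compactness of bounded sequences in the dual *)

Section weak_compactness.
Context {R : realType} {X : normedModType R}.
Implicit Types (f : nat -> dual X) (g : dual X).

(** A sequential form of Banach-Alaoglu: each [f n x] stays in a compact segment, so it converges
    along the ultrafilter, and the limit inherits linearity and the bound [M]. *)
Lemma ultra_limit f (M : R) (U : set_system nat) : UltraFilter U ->
  (forall n, `|f n| <= M) ->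
  exists g, forall x, f n x @[n --> U] --> g x.
Proof.
move=> UU fM.
have M0 : 0 <= M by exact: le_trans (fM 0%N).
have bnd n x : `|f n x| <= M * `|x|.
  by rewrite (le_trans (dual_ub _ _))// ler_wpM2r.
have ex x : exists l : R^o, f n x @[n --> U] --> l.
  have := @segment_compact R (- (M * `|x|)) (M * `|x|).
  rewrite compact_ultra => /(_ ((fun n => f n x) @ U)).
  have /(_ U UU) UF := @ultra_fmap _ _ (fun n => f n x).
  move=> /(_ UF)[|l [_ lim]]; last by exists l.
  apply: (@filterE _ U) => n; rewrite /= in_itv/=.
  by have := bnd n x; rewrite ler_norml.
have /choice[g hg] := ex.
have lg : linear g.
  move=> a x y; apply: (@cvg_unique R^o (@norm_hausdorff _ R^o) _ _ _ _ (hg _)).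
  rewrite (_ : (fun n => f n (a *: x + y)) = (fun n => a *: f n x + f n y)).
    by apply: cvgD => //; exact: cvgZl_tmp.
  by apply/funext => n; rewrite linearP.
pose L := GRing.isLinear.Build R X R^o *:%R g lg.
have [x|G GE _] := @dual_of_bounded _ _ (HB.pack g L : {linear X -> R^o}) M.
  apply: (cvgr_to_le (hg x)); apply: nearW => n.
  exact: le_trans (ler_norm _) (bnd n x).
by exists G => x; rewrite GE; exact: hg.
Qed.

Lemma dual_half_norm g : exists2 u, `|u| <= 1 & `|g| <= 2 * g u.
Proof.
apply: contrapT => h.
have h' u : `|u| <= 1 -> 2 * g u < `|g|.
  by move=> u1; rewrite ltNge; apply/negP => le; apply: h; exists u.
have : `|g| <= `|g| / 2.
  apply: dual_norm_leP; first by rewrite divr_ge0.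
  by move=> u /h'; lra.
have := h' 0; rewrite normr0 linear0 mulr0 => /(_ ler01).
lra.
Qed.

(* By reflexivity the separating functional is evaluation at a point. *)
Lemma closed_convex_wlim (T : Type) (K : set (dual X)) (U : set_system T)
    (f : T -> dual X) g : reflexive_space X -> closed K -> convex_set K ->
  ProperFilter U -> (forall n, K (f n)) ->
  (forall x, f n x @[n --> U] --> g x) -> K g.
Proof.
move=> rX cK cvK UU Kf fg; apply: contrapT => nK.
have [n _] := filter_ex (@filterT _ U _).
have K0 : K !=set0 by exists (f n).
have [phi [e [e0 he]]] := mazur_separation cK cvK K0 nK.
have [x xphi] := rX phi.
have : g x <= g x - e.
  apply: (cvgr_to_le (fg x)); apply: nearW => m.
  by have := he _ (Kf m); rewrite -xphi.
by rewrite lerBrDr gerDl leNgt e0.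
Qed.

(** Rational coefficients keep the combinations countable, so that they can be enumerated by
    [pickle] while remaining dense in the closed linear span. *)
Let comb f (s : seq (rat * nat)) : dual X :=
  \sum_(p <- s) ratr p.1 *: f p.2.

Let span f : set (dual X) := closure (range (comb f)).

Let comb_cat f s t : comb f (s ++ t) = comb f s + comb f t.
Proof. by rewrite /comb big_cat. Qed.

Let comb_scale f (q : rat) s :
  comb f [seq (q * p.1, p.2) | p <- s] = ratr q *: comb f s.
Proof.
rewrite /comb big_map scaler_sumr; apply: eq_bigr => p _.
by rewrite rmorphM scalerA.
Qed.

Let spanP f g : span f g <-> forall e : R, 0 < e -> exists s, `|g - comb f s| < e.
Proof.
rewrite /span closure_normP; split=> h e /h.
  by move=> [_ [s _ <-]]; exists s.
by move=> [s]; exists (comb f s).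
Qed.

Let span_linear f (a : R) g g' : span f g -> span f g' -> span f (a *: g + g').
Proof.
move=> /spanP h /spanP h'; apply/spanP => e e0.
(* Three errors of at most [e / 4] each: replacing [a] by [q], approximating [g], approximating
   [g']. The [1 +] in the denominators avoids dividing by zero. *)
have [q /andP[q1 q2]] : exists q : rat,
    a - e / (4 * (1 + `|g|)) < ratr q < a + e / (4 * (1 + `|g|)).
  have p0 : 0 < e / (4 * (1 + `|g|)) by rewrite divr_gt0// mulr_gt0// ltr_pwDl.
  have [|q] := @rat_in_itvoo R (a - e / (4 * (1 + `|g|))) (a + e / (4 * (1 + `|g|))).
    by lra.
  by rewrite in_itv/=; exists q.
have aq : `|a - ratr q| <= e / (4 * (1 + `|g|)).
  by rewrite ler_norml; apply/andP; split; lra.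
have [|s hs] := h (e / (4 * (1 + `|ratr q : R|))).
  by rewrite divr_gt0// mulr_gt0// ltr_pwDl.
have [|s' hs'] := h' (e / 4); first by rewrite divr_gt0.
exists ([seq (q * p.1, p.2) | p <- s] ++ s').
rewrite comb_cat comb_scale.
have -> : a *: g + g' - (ratr q *: comb f s + comb f s') =
    (a - ratr q) *: g + ratr q *: (g - comb f s) + (g' - comb f s').
  by rewrite scalerBl scalerBr [X in _ = X + _]addrA subrK opprD addrACA.
rewrite (le_lt_trans (ler_normD _ _))// (le_lt_trans (lerD (ler_normD _ _) (lexx _)))//.
rewrite (normrZ (a - ratr q)) (normrZ (ratr q) (g - comb f s)).
have key (b : R) : 0 <= b -> e / (4 * (1 + b)) * b <= e / 4.
  move=> b0; rewrite -subr_ge0.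
  have -> : e / 4 - e / (4 * (1 + b)) * b = e / (4 * (1 + b)) by field; lra.
  by rewrite divr_ge0 ?mulr_ge0 ?addr_ge0// ltW.
have h1 : `|a - ratr q| * `|g| <= e / 4.
  by rewrite (le_trans (ler_wpM2r _ aq))// key.
have h2 : `|ratr q : R| * `|g - comb f s| <= e / 4.
  by rewrite mulrC (le_trans (ler_wpM2r _ (ltW hs)))// key.
by apply: le_lt_trans (lerD (lerD h1 h2) (ltW hs')) _; lra.
Qed.

Let span_convex f : convex_set (span f).
Proof.
apply/convex_setP => x y s _ _ sx sy; apply: span_linear => //.
rewrite -[X in span f X]addr0; apply: span_linear => //.
by rewrite -(scale0r x) -[X in span f X]addr0; apply/spanP => e e0; exists [::];
  rewrite /comb big_nil subr0 scale0r addr0 normr0.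
Qed.

Let span_gen f n : span f (f n).
Proof.
apply/spanP => e e0; exists [:: (1, n)].
by rewrite /comb big_seq1 rmorph1 scale1r subrr normr0.
Qed.

(* A countable set norming the separable space spanned by the sequence detects
   its cluster points, so that it suffices to converge on that set. *)
Theorem weak_seq_compact f (M : R) : reflexive_space X ->
  (forall n, `|f n| <= M) ->
  exists (phi : nat -> nat) g, phi n @[n --> \oo] --> \oo /\
    forall x, f (phi n) x @[n --> \oo] --> g x.
Proof.
move=> rX fM.
(* An ultrafilter finer than [\oo] supplies the candidate limit [g]. *)
have [U [UU ooU]] := @ultraFilterLemma nat \oo _.
have [g fg] := ultra_limit UU fM.
have /choice[z hz] : forall s, exists u, `|u| <= 1 /\ `|comb f s| <= 2 * comb f s u.
  by move=> s; have [u ? ?] := dual_half_norm (comb f s); exists u.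
pose zz (j : nat) := if unpickle j is Some s then z s else 0.
have zzE s : zz (pickle s) = z s by rewrite /zz pickleK.
(* Diagonal extraction: the [k]-th index is accurate to [1 / (k + 1)] on the first [k + 1] test
   vectors. *)
have [|phi phioo hphi] := @subseq_extract (fun k n => forall j : 'I_k.+1,
    `|g (zz j) - f n (zz j)| < k.+1%:R^-1).
  move=> k N.
  have : \forall n \near U, (N <= n)%N /\ forall j : 'I_k.+1,
    `|g (zz j) - f n (zz j)| < k.+1%:R^-1.
    apply: filterI; first by apply: ooU; exact: nbhs_infty_ge.
    apply: filter_forall => j.
    have /cvgrPdist_lt := fg (zz j); apply.
    by rewrite invr_gt0 ltr0n.
  by move=> /filter_ex[n [Nn hn]]; exists n.
have zcv j : f (phi n) (zz j) @[n --> \oo] --> g (zz j).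
  apply/cvgrPdist_lt => e e0.
  have : \forall n \near \oo, (j <= n)%N /\ n.+1%:R^-1 < e.
    apply: filterI; first exact: nbhs_infty_ge.
    have /cvgrPdist_lt/(_ e e0) := @cvg_harmonic R.
    apply: filterS => n; by rewrite /harmonic sub0r normrN ger0_norm ?invr_ge0 ?ler0n.
  apply: filterS => n [jn ne]; apply: lt_trans ne.
  have jn' : (j < n.+1)%N by rewrite ltnS.
  exact: (hphi n (Ordinal jn')).
exists phi, g; split => // x.
(* It remains to see that every ultrafilter limit [g'] of the subsequence is [g]. Both lie in the
   closed span and they agree on all test vectors. *)
apply: cvg_ultra => V UV ooV.
have [g' fg'] := @ultra_limit (f \o phi) M V UV (fun n => fM _).
suff <- : g' = g by exact: fg'.
have sg : span f g.
  by apply: (closed_convex_wlim rX _ _ _ _ fg) => //; exact: closed_closure.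
have sg' : span f g'.
  apply: (closed_convex_wlim rX _ _ _ _ fg') => //; first exact: closed_closure.
  by move=> n; exact: span_gen.
have gz j : g' (zz j) = g (zz j).
  apply: (@cvg_unique R^o (@norm_hausdorff _ R^o) _ _ _ _ (fg' _)).
  by move=> A /zcv; exact: ooV.
apply/eqP; rewrite -subr_eq0 -normr_le0; apply/ler_addgt0Pr => e e0; rewrite add0r.
have : span f (g' - g) by rewrite addrC -scaleN1r; exact: span_linear.
(* Since [g' - g] vanishes at [z s], the norm of [comb f s] is at most twice its distance to
   [g' - g]; hence the factor 3. *)
move=> /spanP/(_ (e / 3))[|s hs]; first by rewrite divr_gt0.
have [z1 hzs] := hz s.
have h0 : (g' - g) (z s) = 0 by rewrite dualB -zzE gz subrr.
have h1 : comb f s (z s) <= `|g' - g - comb f s|.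
  have := dual_ge (g' - g - comb f s) (z s); rewrite dualB h0 sub0r lerN2 => h.
  by rewrite (le_trans h)// ler_piMr.
have h2 : `|g' - g| <= `|g' - g - comb f s| + `|comb f s|.
  by rewrite -[X in `|X| <= _](subrK (comb f s)) ler_normD.
lra.
Qed.

End weak_compactness.

(** * Consequences of the Banach-Steinhaus theorem *)

Section uniform_boundedness.
Context {R : realType} {X : completeNormedModType R}.

Lemma dual_uniform_bound (F : set (dual X)) :
  (forall x, exists M : R, forall f, F f -> f x <= M) ->
  exists M : R, forall f, F f -> `|f| <= M.
Proof.
move=> h.
have ub : uniform_bounded [set (f : X -> R^o) | f in F].
  apply: Banach_Steinhauss.
    move=> _ [f Ff <-]; split; last exact: dual_linear.
    move=> r; exists (`|f| * r) => x xr.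
    by rewrite (le_trans (dual_ub f x))// ler_wpM2l.
  move=> x; have [M hM] := h x; have [M' hM'] := h (- x).
  exists (Num.max M M') => _ [f Ff <-].
  rewrite ler_norml le_max hM// andbT lerNl le_max.
  by rewrite -linearN hM'// orbT.
have [M hM] := ub 1.
exists `|M| => f Ff; apply: dual_norm_leP => // u u1.
rewrite (le_trans (ler_norm _))// (le_trans _ (ler_norm _))//.
by apply: hM => //; exists f.
Qed.

Lemma dual_cvg_bounded (f : nat -> dual X) (g : dual X) :
  (forall x, f n x @[n --> \oo] --> g x) ->
  exists M : R, forall n, `|f n| <= M.
Proof.
move=> fg; have [x|M hM] := @dual_uniform_bound (range f); last first.
  by exists M => n; apply: hM; exists n.
have /cvg_seq_bounded/bounded_fun_has_ubound : cvgn (fun n => f n x).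
  by apply/cvg_ex; exists (g x).
by move=> [M hM]; exists M => _ [n _ <-]; apply: hM; exists n.
Qed.

(** Pointwise convergence makes the functionals bounded in norm, so the error [f n (w n - v)] tends
    to zero. *)
Lemma dual_cvg_pairing (f : nat -> dual X) (g : dual X) (w : nat -> X) v :
  (forall x, f n x @[n --> \oo] --> g x) -> w n @[n --> \oo] --> v ->
  f n (w n) @[n --> \oo] --> g v.
Proof.
move=> fg wv; have [M hM] := dual_cvg_bounded fg.
rewrite (_ : (fun n => f n (w n)) = (fun n => f n v + f n (w n - v))); last first.
  by apply/funext => n; rewrite -linearD subrKC.
rewrite -[g v]addr0; apply: cvgD => //.
apply: norm_cvg0.
have le0 : \forall n \near \oo, 0 <= `|f n (w n - v)| <= M * `|w n - v|.
  apply: nearW => n; rewrite normr_ge0/= (le_trans (dual_ub _ _))//.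
  by rewrite ler_wpM2r.
apply: (squeeze_cvgr le0); first exact: cvg_cst.
rewrite -[X in _ --> X](mulr0 M); apply: cvgMl_tmp.
rewrite -(@normr0 _ X); apply: cvg_norm.
by rewrite -(subrr v); apply: cvgB => //; exact: cvg_cst.
Qed.

End uniform_boundedness.

(** * Monotone operators and the geometry of their domains *)

Section monotone.
Context {R : realType} {X : completeNormedModType R}.
Implicit Types (A : X -> set (dual X)).

(** Otherwise adding [(z, zs)] to the graph would be a proper monotone extension. *)
Lemma maximal_monotoneP A z (zs : dual X) : maximal_monotone A ->
  (forall u us, A u us -> us (z - u) <= zs (z - u)) -> A z zs.
Proof.
move=> [mA maxA] h; apply: contrapT => nA.
pose B x : set (dual X) := [set xs | A x xs \/ x = z /\ xs = zs].
apply: (maxA B).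
  move=> x y xs ys [Ax|[-> ->]] [Ay|[-> ->]]; first exact: mA.
  - have := h _ _ Ax; rewrite dualB -(opprB z x) !linearN => hx.
    by rewrite opprK addrC subr_ge0.
  - by have := h _ _ Ay; rewrite dualB subr_ge0.
  - by rewrite !subrr linear0.
split=> [[x xs]|BA]; first by left.
by apply: nA; apply: (BA (z, zs)); right.
Qed.

Lemma monotone_le A x y (xs ys : dual X) : monotone_op A -> A x xs -> A y ys ->
  ys (x - y) <= xs (x - y).
Proof. by move=> mA Ax Ay; have := mA _ _ _ _ Ax Ay; rewrite dualB subr_ge0. Qed.

(* Banach-Steinhaus applies to the functionals [us] rescaled by
   [1 + |us| * |u|]; for small [u] the rescaling is then absorbed. *)
Lemma monotone_locally_bounded A y : monotone_op A -> interior (op_dom A) y ->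
  exists r K : R, [/\ 0 < r, 0 <= K,
    forall u, `|u| <= r -> op_dom A (y + u) &
    forall u us, `|u| <= r -> A (y + u) us -> `|us| <= K].
Proof.
move=> mA /interior_normP[r0 r00 hr0].
pose F := [set (1 + `|p.2| * `|p.1|)^-1 *: p.2 |
  p in [set p : X * dual X | `|p.1| <= 1 /\ A (y + p.1) p.2]].
have pos (u : X) (us : dual X) : 0 < 1 + `|us| * `|u| by rewrite ltr_pwDl ?mulr_ge0.
have [w|M hM] := @dual_uniform_bound _ X F.
  (* With this [c] the point [y + c w] is in the domain, and monotonicity against it bounds [us w]
     by a multiple of [1 + |us| * |u|]. *)
  pose c := r0 / (1 + `|w|).
  have w1 : 0 < 1 + `|w| by rewrite ltr_pwDl.
  have c0 : 0 < c by rewrite divr_gt0.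
  have [as_ Aas] : op_dom A (y + c *: w).
    apply: hr0; rewrite normrZ gtr0_norm// /c mulrAC ler_pdivrMr//.
    by rewrite ler_pM2l// lerDr.
  pose B := `|as_| * (1 + `|c *: w|).
  have B0 : 0 <= B by rewrite mulr_ge0// addr_ge0.
  exists ((1 + B) / c) => _ [[u us] /= [u1 Aus] <-].
  rewrite dualZ mulrC ler_pdivrMr// mulrAC ler_pdivlMr//.
  have := monotone_le mA Aus Aas; rewrite opprD addrACA subrr add0r.
  have := dual_ge as_ (u - c *: w).
  have : `|as_| * `|u - c *: w| <= B.
    by rewrite ler_wpM2l// (le_trans (ler_normB _ _))// lerD2r.
  have -> : us (u - c *: w) = us u - c * us w by rewrite linearB linearZ.
  have := dual_le us u.
  set t := `|us| * `|u|; have t0 : 0 <= t by rewrite mulr_ge0.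
  move=> h1 h2 h3 h4.
  have h5 : c * us w <= t + B by lra.
  rewrite mulrC (le_trans h5)//.
  have : 0 <= B * t by exact: mulr_ge0.
  by nra.
(* For [|u| <= 1 / (2 M')] the bound [|us| <= M' (1 + |us| |u|)] becomes [|us| <= M' + |us| / 2].
   Having [M' >= 1] ensures [|u| <= 1]. *)
pose M' := Num.max M 1.
have M'1 : 1 <= M' by rewrite le_max lexx orbT.
pose r := Num.min r0 (2 * M')^-1.
have M'0 : 0 < 2 * M' by lra.
exists r, (2 * M'); split.
- by rewrite lt_min r00 invr_gt0.
- exact: ltW.
- by move=> u ur; apply: hr0; rewrite (le_trans ur)// ge_min lexx.
move=> u us ur Aus.
have uM : `|u| <= (2 * M')^-1 by rewrite (le_trans ur)// ge_min lexx orbT.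
have u1 : `|u| <= 1.
  by rewrite (le_trans uM)// invf_le1//; lra.
have : `|(1 + `|us| * `|u|)^-1 *: us| <= M' by rewrite le_max hM//; exists (u, us).
rewrite normrZ gtr0_norm ?invr_gt0// mulrC ler_pdivrMr// => h.
have : `|us| * `|u| <= `|us| * (2 * M')^-1 by rewrite ler_wpM2l.
rewrite -(ler_pM2l (lt_le_trans ltr01 M'1)) => h'.
have : M' * (`|us| * (2 * M')^-1) = `|us| / 2 by field; lra.
lra.
Qed.

(* For weights [s_i >= 0] on points [(u_i, us_i)] of the graph, [(l, p, q, e)]
   collects the sums of [s_i], [s_i u_i], [s_i us_i] and [s_i us_i(u_i)]. *)
Inductive graph_cone A : R -> X -> dual X -> R -> Prop :=
| graph_cone0 : graph_cone A 0 0 0 0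
| graph_cone_gen u us : A u us -> graph_cone A 1 u us (us u)
| graph_coneD l p q e l' p' q' e' : graph_cone A l p q e ->
    graph_cone A l' p' q' e' -> graph_cone A (l + l') (p + p') (q + q') (e + e')
| graph_coneZ s l p q e : 0 < s -> graph_cone A l p q e ->
    graph_cone A (s * l) (s *: p) (s *: q) (s * e).

Lemma graph_cone_ge0 A l p q e : graph_cone A l p q e -> 0 <= l.
Proof.
elim=> {l p q e}//.
- by move=> l p q e l' p' q' e' _ l0 _ l0'; exact: addr_ge0.
- by move=> s l p q e s0 _ l0; rewrite mulr_ge0// ltW.
Qed.

Lemma graph_cone_mono A l p q e a (as_ : dual X) : monotone_op A ->
  graph_cone A l p q e -> A a as_ -> q a - e <= as_ (l *: a - p).
Proof.
move=> mA + Aa; elim=> {l p q e}.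
- by rewrite scale0r !subr0 linear0.
- move=> u us Au; have := monotone_le mA Aa Au.
  by rewrite scale1r linearB.
- move=> l p q e l' p' q' e' _ h _ h'.
  rewrite dualD scalerDl !opprD addrACA (addrACA (l *: a)) linearD.
  exact: lerD.
- move=> s l p q e s0 _ h.
  by rewrite dualZ -mulrBr -scalerA -scalerBr linearZ ler_pM2l.
Qed.

(** The weighted sum of the monotonicity inequalities over all pairs of points of the two
    combinations. *)
Lemma graph_cone_pairing A l p q e l' p' q' e' : monotone_op A ->
  graph_cone A l p q e -> graph_cone A l' p' q' e' ->
  q p' + q' p <= l * e' + l' * e.
Proof.
move=> mA c; elim=> {l' p' q' e'}.
- by rewrite linear0 mulr0 mul0r addr0.
- move=> u us Au; have := graph_cone_mono mA c Au.
  by rewrite linearB linearZ/= => h; rewrite mul1r; move: h; rewrite /GRing.scale/=; lra.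
- move=> l1 p1 q1 e1 l2 p2 q2 e2 _ h1 _ h2.
  by rewrite dualD linearD; lra.
- move=> s l1 p1 q1 e1 s0 _ h.
  have -> : q (s *: p1) = s * q p1 by rewrite linearZ.
  have -> : (s *: q1) p = s * q1 p by [].
  have : s * (q p1 + q1 p) <= s * (l * e1 + l1 * e) by rewrite ler_pM2l.
  lra.
Qed.

(** This inequality makes the problem of extending the graph at [z] solvable. It comes from
    monotonicity against [x] and against a whole ball around [y], where [A] is bounded. *)
Lemma graph_cone_bound A x y (t : R) : monotone_op A -> op_dom A x ->
  interior (op_dom A) y -> 0 < t -> t <= 1 ->
  let z := (1 - t) *: x + t *: y in
  exists2 K : R, 0 <= K & forall l p q e, graph_cone A l p q e ->
    q z - e <= K * `|l *: z - p|.
Proof.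
move=> mA [xs Ax] yi t0 t1 z.
have [r [K1 [r0 K10 hdom hbnd]]] := monotone_locally_bounded mA yi.
pose C2 := `|xs| + K1.
pose C1 := `|xs| * `|x - z| + K1 * (`|y - z| + r).
have C20 : 0 <= C2 by rewrite addr_ge0.
have C10 : 0 <= C1.
  by rewrite addr_ge0 ?mulr_ge0// addr_ge0// ltW.
have tr0 : 0 < t * r by rewrite mulr_gt0.
pose K := C2 + C1 / (t * r).
have KC2 : C2 <= K by rewrite lerDl divr_ge0// ltW.
exists K; first exact: le_trans KC2.
move=> l p q e c; have l0 := graph_cone_ge0 c.
set N := `|l *: z - p|; have N0 : 0 <= N by exact: normr_ge0.
(* The inequalities at [x] and at [y + r u], with weights [1 - t] and [t]. *)
have main u : `|u| <= 1 -> q z + t * r * q u - e <= C2 * N + l * C1.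
  move=> u1.
  have ru : `|r *: u| <= r by rewrite normrZ gtr0_norm// ler_piMr// ltW.
  have [as_ Aas] := hdom _ ru.
  have as_K := hbnd _ _ ru Aas.
  have i1 := graph_cone_mono mA c Ax.
  have i2 := graph_cone_mono mA c Aas.
  have b1 : xs (l *: x - p) <= `|xs| * (N + l * `|x - z|).
    rewrite (le_trans (dual_le _ _))// ler_wpM2l//.
    have -> : l *: x - p = (l *: z - p) + l *: (x - z).
      by rewrite scalerBr [RHS]addrC subrKA.
    by rewrite (le_trans (ler_normD _ _))// lerD2l normrZ ger0_norm.
  have b2 : as_ (l *: (y + r *: u) - p) <= K1 * (N + l * (`|y - z| + r)).
    rewrite (le_trans (dual_le _ _))// ler_pM//.
    have -> : l *: (y + r *: u) - p = (l *: z - p) + l *: ((y - z) + r *: u).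
      by rewrite (addrAC y) scalerBr [RHS]addrC subrKA.
    rewrite (le_trans (ler_normD _ _))// lerD2l normrZ ger0_norm//.
    by rewrite ler_wpM2l// (le_trans (ler_normD _ _))// lerD2l.
  have qz : q z = (1 - t) * q x + t * q y by rewrite linearD !linearZ.
  have qy : q (y + r *: u) = q y + r * q u by rewrite linearD linearZ.
  rewrite qy in i2.
  have j1 : (1 - t) * (q x - e) <= (1 - t) * (`|xs| * (N + l * `|x - z|)).
    by rewrite ler_wpM2l ?subr_ge0// (le_trans i1).
  have j2 : t * (q y + r * q u - e) <= t * (K1 * (N + l * (`|y - z| + r))).
    by rewrite ler_wpM2l ?(ltW t0)// (le_trans i2).
  have k1 : (1 - t) * (`|xs| * (N + l * `|x - z|)) <= `|xs| * (N + l * `|x - z|).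
    by rewrite ler_piMl ?mulr_ge0 ?addr_ge0 ?mulr_ge0//; lra.
  have k2 : t * (K1 * (N + l * (`|y - z| + r))) <= K1 * (N + l * (`|y - z| + r)).
    by rewrite ler_piMl ?mulr_ge0 ?addr_ge0 ?mulr_ge0 ?addr_ge0// ltW.
  rewrite qz /C2 /C1.
  move: j1 j2 k1 k2; clear; lra.
have C2K : C2 * N <= K * N by rewrite ler_wpM2r.
have CK : l * C1 <= t * r * (l * K).
  have -> : t * r * (l * K) = t * r * (l * C2) + l * C1.
    by rewrite /K; field; rewrite !gt_eqF.
  by rewrite lerDr mulr_ge0 ?mulr_ge0// ltW.
(* If [q u > l K] for some unit-ball [u], the term [t r q u] in [main] absorbs [l C1]. Otherwise
   [|q| <= l K], and pairing the combination with itself gives [q p <= l e], so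
   [l (q z - e) <= q (l z - p) <= l K N]. *)
have [hA|hB] := pselect (forall u, `|u| <= 1 -> q u <= l * K); last first.
  have [u [u1 qu]] : exists u, `|u| <= 1 /\ l * K < q u.
    apply: contrapT => nu; apply: hB => u u1; rewrite leNgt; apply/negP => lu.
    by apply: nu; exists u.
  have := main u u1.
  have : t * r * (l * K) < t * r * q u by rewrite ltr_pM2l.
  lra.
have [l00|lN0] := eqVneq l 0.
  have := main 0; rewrite normr0 linear0 mulr0 addr0 => /(_ ler01).
  by rewrite l00 mul0r addr0; lra.
have lp : 0 < l by rewrite lt_def lN0.
rewrite -(ler_pM2l lp) mulrA.
have qn : `|q| <= l * K by apply: dual_norm_leP => //; rewrite mulr_ge0// addr_ge0 ?divr_ge0// ltW.
have pp := graph_cone_pairing mA c c.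
have : q (l *: z - p) <= l * K * N.
  by rewrite (le_trans (dual_le _ _))// ler_wpM2r.
have -> : q (l *: z - p) = l * q z - q p by rewrite linearB linearZ.
lra.
Qed.

(** By maximality it is enough to find [zs] monotonically related to the graph at [z]. Hahn-Banach
    gives it below the infimum over the graph cone of [K |d + l z - p| - (q z - e)], which is
    nonnegative at [d = 0] by [graph_cone_bound]. *)
Lemma segment_op_dom A x y (t : R) : maximal_monotone A -> op_dom A x ->
  interior (op_dom A) y -> 0 < t -> t <= 1 ->
  op_dom A ((1 - t) *: x + t *: y).
Proof.
move=> mmA Ax yi t0 t1; have [mA _] := mmA.
have := graph_cone_bound mA Ax yi t0 t1.
move=> /=; set z := (_ + _) => -[K K0 hK].
pose E := [set dk : X * R | exists l p q e, graph_cone A l p q e /\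
  K * `|dk.1 + (l *: z - p)| - (q z - e) <= dk.2].
have E0 d : E (d, K * `|d|).
  exists 0, 0, 0, 0; split; first exact: graph_cone0.
  by rewrite /= scale0r !subr0 addr0.
have [||d|f hf] := @hahn_banach_conic _ X E.
- split.
  + move=> d d' k k' [l [p [q [e [c h]]]]] [l' [p' [q' [e' [c' h']]]]].
    exists (l + l'), (p + p'), (q + q'), (e + e'); split; first exact: graph_coneD.
    cbn [fst snd] in h, h' |- *; rewrite dualD scalerDl opprD.
    rewrite (addrACA (l *: z)) (addrACA d).
    have := ler_wpM2l K0 (ler_normD (d + (l *: z - p)) (d' + (l' *: z - p'))).
    lra.
  + move=> s d k s0 [l [p [q [e [c h]]]]].
    exists (s * l), (s *: p), (s *: q), (s * e); split; first exact: graph_coneZ.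
    cbn [fst snd] in h |- *; rewrite dualZ -scalerA -scalerBr -scalerDr normrZ gtr0_norm//.
    by rewrite mulrCA -!mulrBr ler_pM2l.
  + move=> k [l [p [q [e [c /=]]]]]; rewrite add0r => h.
    by have := hK _ _ _ _ c; lra.
- by have := E0 0; rewrite normr0 mulr0.
- by exists (K * `|d|); exact: E0.
have [x'|zs zsE _] := @dual_of_bounded _ _ f K; first exact: hf (E0 _).
exists zs; apply: maximal_monotoneP => // u us Au.
rewrite zsE -[z - u]opprB (linearN f) (linearN us) lerN2.
(* With weight one at [(u, us)] and [d = u - z] the norm term vanishes. *)
rewrite (linearB us); apply: hf; exists 1, u, us, (us u).
split; first exact: graph_cone_gen.
by rewrite /= scale1r subrKA subrr normr0 mulr0 sub0r opprB.
Qed.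

(** A displacement [u] of the point of the segment is the displacement [u / t] of its endpoint [y],
    so a ball of radius [r] around [y] yields one of radius [t r]. *)
Lemma segment_interior A x y (t : R) : maximal_monotone A -> op_dom A x ->
  interior (op_dom A) y -> 0 < t -> t <= 1 ->
  interior (op_dom A) ((1 - t) *: x + t *: y).
Proof.
move=> mmA Ax yi t0 t1.
have : interior (interior (op_dom A)) y.
  by rewrite (interior_id _).1//; exact: open_interior.
move=> /interior_normP[r r0 hr]; apply/interior_normP.
exists (t * r); first exact: mulr_gt0.
move=> u ur; have -> : (1 - t) *: x + t *: y + u = (1 - t) *: x + t *: (y + t^-1 *: u).
  by rewrite scalerDr scalerA divff ?gt_eqF// scale1r addrA.
apply: segment_op_dom => //; apply: hr.
by rewrite normrZ gtr0_norm ?invr_gt0// ler_pdivrMl.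
Qed.

Lemma op_dom_sub_closure_interior A : maximal_monotone A ->
  interior (op_dom A) !=set0 ->
  closure (op_dom A) `<=` closure (interior (op_dom A)).
Proof.
move=> mmA [y yi].
rewrite [X in _ `<=` X](closure_id (closure (interior (op_dom A)))).1;
  last exact: closed_closure.
apply: closure_subset => x Ax; apply/closure_normP => e e0.
pose t := Num.min 1 (e / 2 / (1 + `|x - y|)).
have p0 : 0 < 1 + `|x - y| by rewrite ltr_pwDl.
have e20 : 0 < e / 2 by rewrite divr_gt0.
have t0 : 0 < t by rewrite lt_min ltr01 divr_gt0.
exists ((1 - t) *: x + t *: y).
  by apply: segment_interior => //; rewrite ge_min lexx.
have -> : x - ((1 - t) *: x + t *: y) = t *: (x - y).
  by rewrite scalerBl scale1r opprD opprB addrA (addrC x) subrK scalerBr.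
rewrite normrZ gtr0_norm//.
have : t * (1 + `|x - y|) <= e / 2.
  by rewrite -ler_pdivlMr// ge_min lexx orbT.
lra.
Qed.

End monotone.

(** * Half-spaces, closed convex hulls and weak convergence *)

Lemma dual_closure_le {R : realType} {Y : normedModType R} (g : dual Y)
    (S : set Y) (c : R) : (forall y, S y -> g y <= c) ->
  forall y, closure S y -> g y <= c.
Proof.
move=> h y /closure_normP cS; apply/ler_addgt0Pr => e e0.
have p0 : 0 < 1 + `|g| by rewrite ltr_pwDl.
have [|y' Sy' yy'] := cS (e / (1 + `|g|)); first by rewrite divr_gt0.
rewrite -(subrKC y' y) linearD lerD ?h// (le_trans (dual_le _ _))//.
move: yy'; rewrite ltr_pdivlMr// mulrDr mulr1 => yy'.
rewrite mulrC ltW// (le_lt_trans _ yy')// lerDr//.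
Qed.

Lemma closed_convex_hull_sub {R : realType} {Y : normedModType R}
    (S K : set Y) : closed K -> convex_set K -> S `<=` K ->
  closed_convex_hull S `<=` K.
Proof. by move=> cK vK SK; exact: smallest_sub. Qed.

Lemma closed_convex_hull_mono {R : realType} {Y : normedModType R}
    (S T : set Y) : S `<=` T -> closed_convex_hull S `<=` closed_convex_hull T.
Proof. by move=> ST x hx K [cK TK]; apply: hx; split=> // y /ST/TK. Qed.

(** By reflexivity a functional separating [f] from the hull is evaluation at some [z], where the
    support inequality fails. *)
Lemma closed_convex_hull_support {R : realType} {X : normedModType R}
    (M : set (dual X)) (f : dual X) : reflexive_space X -> M !=set0 ->
  (forall d k, (forall m, M m -> m d <= k) -> f d <= k) ->
  closed_convex_hull M f.
Proof.
move=> rX [m0 Mm0] h K [[cK vK] MK]; apply: contrapT => nK.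
have K0 : K !=set0 by exists m0; exact: MK.
have [phi [e [e0 he]]] := mazur_separation cK vK K0 nK.
have [z zphi] := rX phi.
have : f z <= f z - e.
  by apply: h => m /MK/he; rewrite -zphi.
by rewrite lerBrDr gerDl leNgt e0.
Qed.

Lemma weak_cvg_eval {R : realType} {X : normedModType R} (f : nat -> dual X) g :
  weak_cvg f g -> forall x, f n x @[n --> \oo] --> g x.
Proof. by move=> fg x; exact: (fg (bidual x)). Qed.

(** * Values of the operator and weak limits of selections *)

Section limits_of_selections.
Context {R : realType} {X : completeNormedModType R}.
Context (A : X -> set (dual X)) (D : set X) (At : X -> dual X).
Hypothesis mmA : maximal_monotone A.
Hypothesis DA : dense_subset D (op_dom A).
Hypothesis sA : selection A At.

Let mA : monotone_op A. Proof. by case: mmA. Qed.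

Lemma maximal_monotone_closed x : closed (A x).
Proof.
rewrite closure_id; apply/seteqP; split; first exact: subset_closure.
move=> xs cxs; apply: maximal_monotoneP => // u us Au.
have := @dual_closure_le _ _ (- bidual (x - u)) (A x) (- us (x - u)) _ xs cxs.
rewrite dualN lerN2; apply => ys Ax.
by rewrite dualN lerN2; exact: monotone_le Ax Au.
Qed.

Lemma maximal_monotone_convex x : convex_set (A x).
Proof.
apply/convex_setP => a b s s0 s1 Aa Ab; apply: maximal_monotoneP => // u us Au.
have ha := monotone_le mA Aa Au; have hb := monotone_le mA Ab Au.
rewrite dualD !dualZ.
have : s * us (x - u) <= s * a (x - u) by rewrite ler_wpM2l.
have : (1 - s) * us (x - u) <= (1 - s) * b (x - u) by rewrite ler_wpM2l ?subr_ge0.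
lra.
Qed.

(** A normal vector is nonpositive on [u - x] for [u] in the domain, so adding it preserves every
    monotonicity inequality. *)
Lemma add_normal_cone x : set_add (A x) (normal_cone x (closure (op_dom A))) `<=` A x.
Proof.
move=> _ [a Aa [b [_ Nb] <-]]; apply: maximal_monotoneP => // u us Au.
have : b (u - x) <= 0.
  rewrite -lee_fin; apply: le_trans Nb; apply: ereal_sup_ubound.
  by exists u => //; apply: subset_closure; exists us.
have := monotone_le mA Aa Au.
by rewrite -(opprB x u) linearN dualD; lra.
Qed.

Lemma wLimsup_dir_sub x v : wLimsup_dir At D x v `<=` wLimsup At D x.
Proof.
move=> xs [w [t [wv t0 tp Dw wcv]]]; exists (fun n => x + t n *: w n); split => //.
rewrite -[X in _ --> X]addr0; apply: cvgD; first exact: cvg_cst.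
by rewrite -(scale0r v); exact: cvgZ.
Qed.

(** The monotonicity inequality passes to the limit, because weakly convergent functionals are
    paired with norm convergent points. *)
Lemma wLimsup_sub x : wLimsup At D x `<=` A x.
Proof.
move=> xs [y [yx Dy /weak_cvg_eval wcv]]; apply: maximal_monotoneP => // u us Au.
have yu : y n - u @[n --> \oo] --> x - u by apply: cvgB => //; exact: cvg_cst.
have usy : us (y n - u) @[n --> \oo] --> us (x - u).
  by apply: (@dual_cvg_pairing _ _ (fun=> us)) => // z; exact: cvg_cst.
apply: (ler_cvg_to usy (dual_cvg_pairing wcv yu)); apply: nearW => n; apply: monotone_le Au => //.
by apply: sA; case: DA => + _; exact.
Qed.

(* Monotonicity against [x] bounds [At (x + t w)] from below in direction [w],
   and against a ball around [x + w] it then bounds its norm, uniformly in [t]. *)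
Lemma directional_bound x xs v : A x xs -> interior (op_dom A) (x + v) ->
  exists r B : R, 0 < r /\ forall (t : R) w zs, 0 < t -> t <= 1 ->
    `|w - v| <= r -> A (x + t *: w) zs -> xs w <= zs w /\ `|zs| <= B.
Proof.
move=> Ax vi; have [r0 [K [r00 K0 hdom hbnd]]] := monotone_locally_bounded mA vi.
pose r := r0 / 2; pose W := `|v| + r.
have rp : 0 < r by rewrite divr_gt0.
have W0 : 0 <= W by rewrite addr_ge0// ltW.
exists r, ((`|xs| * W + K * (W + r)) / r); split => // t w zs t0 t1 wv Az.
have wW : `|w| <= W by rewrite -(subrKC v w) (le_trans (ler_normD _ _))// lerD2l.
have h1 : xs w <= zs w.
  have := monotone_le mA Az Ax; rewrite addrAC subrr add0r !linearZ.
  by rewrite ler_pM2l.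
split => //; apply: dual_norm_leP.
  by rewrite divr_ge0 ?addr_ge0 ?mulr_ge0 ?addr_ge0// ltW.
move=> u u1.
have ru : `|r *: u| <= r by rewrite normrZ gtr0_norm// ler_piMr// ltW.
(* The comparison point [x + w + r u] is written around [x + v]; the choice [r = r0 / 2] keeps it in
   the ball of radius [r0]. *)
have wu : `|(w - v) + r *: u| <= r0.
  by rewrite (le_trans (ler_normD _ _))//; move: wv ru; rewrite /r; lra.
have [as_ Aa] := hdom _ wu; have aK := hbnd _ _ wu Aa.
have h2 := monotone_le mA Az Aa.
have eqd : x + t *: w - (x + v + (w - v + r *: u)) = - ((1 - t) *: w + r *: u).
  rewrite -(addrA x v) [v + _]addrA subrKC opprD addrACA subrr add0r.
  by rewrite scalerBl scale1r !opprD opprK addrA [- w + _]addrC.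
have zsE : zs ((1 - t) *: w + r *: u) = (1 - t) * zs w + r * zs u.
  by rewrite linearD !linearZ.
have gN (g : dual X) d : g (- d) = - g d by exact: linearN.
rewrite eqd !gN lerN2 zsE in h2.
have h3 : as_ ((1 - t) *: w + r *: u) <= K * (W + r).
  rewrite (le_trans (dual_le _ _))// ler_pM//.
  rewrite (le_trans (ler_normD _ _))// lerD// normrZ ger0_norm ?subr_ge0//.
  by rewrite (le_trans _ wW)// ler_piMl//; lra.
have h4 : - (`|xs| * W) <= (1 - t) * zs w.
  have h5 : - (`|xs| * W) <= xs w.
    by rewrite (le_trans _ (dual_ge _ _))// lerN2 ler_wpM2l.
  have h6 : (1 - t) * xs w <= (1 - t) * zs w by rewrite ler_wpM2l ?subr_ge0.
  have : 0 <= t * (`|xs| * W) by rewrite !mulr_ge0// ltW.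
  have : (1 - t) * (- (`|xs| * W)) <= (1 - t) * xs w by rewrite ler_wpM2l ?subr_ge0.
  lra.
rewrite ler_pdivlMr//.
lra.
Qed.

Lemma wLimsup_dir_ex x xs v : reflexive_space X -> A x xs ->
  interior (op_dom A) (x + v) ->
  exists2 m, wLimsup_dir At D x v m & xs v <= m v.
Proof.
move=> rX Ax vi; have [r [B [r0 hB]]] := directional_bound Ax vi.
pose t (n : nat) : R := n.+1%:R^-1.
have tp n : 0 < t n by rewrite invr_gt0 ltr0n.
have t1 n : t n <= 1 by rewrite invf_le1 ?ltr0n// ler1n.
have tcv : t n @[n --> \oo] --> (0 : R) by exact: cvg_harmonic.
have /choice[w hw] : forall n, exists w,
    [/\ `|w - v| <= r, `|w - v| <= t n & D (x + t n *: w)].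
  move=> n.
  have : closure D (x + t n *: v).
    case: DA => _; apply.
    have -> : x + t n *: v = (1 - t n) *: x + t n *: (x + v).
      by rewrite scalerBl scale1r scalerDr addrA subrK.
    by apply: segment_op_dom => //; exists xs.
  (* The tolerance carries a factor [t n] because the error is divided by [t n] when passing from
     the point [d] to its direction. *)
  move=> /closure_normP/(_ (t n * Num.min r (t n)))[|d Dd hd].
    by rewrite mulr_gt0// lt_min r0 tp.
  exists ((t n)^-1 *: (d - x)).
  have tdx : t n *: ((t n)^-1 *: (d - x)) = d - x.
    by rewrite scalerA divff ?gt_eqF// scale1r.
  have : `|(t n)^-1 *: (d - x) - v| < Num.min r (t n).
    rewrite -(ltr_pM2l (tp n)) -[X in X * `|_|](gtr0_norm (tp n)) -normrZ.
    by rewrite scalerBr tdx distrC opprB addrA [t n *: v + x]addrC.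
  rewrite lt_min => /andP[/ltW ? /ltW ?]; split => //.
  by rewrite tdx subrKC.
pose z n := At (x + t n *: w n).
have zb n : xs (w n) <= z n (w n) /\ `|z n| <= B.
  have [wr wt Dw] := hw n; apply: (hB (t n)) => //.
  by apply: sA; case: DA => + _; exact.
have [phi [m [phioo zm]]] := weak_seq_compact rX (fun n => (zb n).2).
have wcv : w n @[n --> \oo] --> v.
  apply/cvgrPdist_le => e e0.
  have /cvgrPdist_le/(_ e e0) := tcv; apply: filterS => n.
  rewrite sub0r normrN gtr0_norm// distrC => tn.
  by have [_ wt _] := hw n; exact: le_trans tn.
have wphi : w (phi n) @[n --> \oo] --> v by exact: cvg_comp wcv.
exists m.
  exists (w \o phi), (t \o phi); split => //=.
  - exact: cvg_comp tcv.
  - by move=> n; have [] := hw (phi n).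
  - by move=> Phi; have [p <-] := rX Phi; exact: zm.
have xsw : xs (w (phi n)) @[n --> \oo] --> xs v.
  by apply: (@dual_cvg_pairing _ _ (fun=> xs)) => // p; exact: cvg_cst.
apply: (ler_cvg_to xsw (@dual_cvg_pairing _ _ (z \o phi) _ _ _ zm wphi)).
by apply: nearW => n; have [] := zb (phi n).
Qed.

End limits_of_selections.

(** * Decomposition of a value into a hull element and a normal vector *)

Section decomposition.
Context {R : realType} {X : completeNormedModType R}.
Context (A : X -> set (dual X)) (D : set X) (At : X -> dual X).
Hypothesis rX : reflexive_space X.
Hypothesis mmA : maximal_monotone A.
Hypothesis intA : interior (op_dom A) !=set0.
Hypothesis DA : dense_subset D (op_dom A).
Hypothesis sA : selection A At.

Let mA : monotone_op A. Proof. by case: mmA. Qed.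

Let dirs x : set (dual X) :=
  \bigcup_(v in [set y - x | y in interior (op_dom A)]) wLimsup_dir At D x v.

Lemma interior_op_dom_convex x v v' (s : R) : 0 <= s -> s <= 1 ->
  interior (op_dom A) (x + v) -> interior (op_dom A) (x + v') ->
  interior (op_dom A) (x + (s *: v + (1 - s) *: v')).
Proof.
(* [segment_interior] needs a positive weight, so [s = 0] is treated apart. *)
move=> s0 s1 iv iv'; have [->|sN0] := eqVneq s 0.
  by rewrite scale0r add0r subr0 scale1r.
have -> : x + (s *: v + (1 - s) *: v') = (1 - s) *: (x + v') + s *: (x + v).
  rewrite !scalerDr addrACA -scalerDl subrK scale1r; congr (_ + _).
  exact: addrC.
by apply: segment_interior => //; [exact: interior_subset|rewrite lt_def sN0].
Qed.

(* A functional squeezed between [xs] on the directions of the interior and the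
   support function of the directional limits: it lies in their closed convex
   hull, and differs from [xs] by a normal vector. *)
Lemma directional_decomposition x xs : A x xs ->
  set_add (closed_convex_hull (dirs x)) (normal_cone x (closure (op_dom A))) xs.
Proof.
move=> Ax; have [y0 y0i] := intA.
pose V v := interior (op_dom A) (x + v).
have Vy y : interior (op_dom A) y -> V (y - x) by rewrite /V subrKC.
pose v0 := y0 - x; have Vv0 : V v0 by exact: Vy.
have dirsA m : dirs x m -> A x m.
  by move=> [v _ /wLimsup_dir_sub]; exact: wLimsup_sub.
have dirs_ex v : V v -> exists2 m, dirs x m & xs v <= m v.
  move=> Vv; have [m mv xm] := wLimsup_dir_ex mmA DA sA rX Ax Vv.
  by exists m => //; exists v => //; exists (x + v) => //; rewrite addrAC subrr add0r.
have [r [K [r0 K0 hdom hbnd]]] := monotone_locally_bounded mA Vv0.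
pose Kb := K * (`|v0| + r).
(* Monotonicity against a ball around [x + v0] gives a bound uniform in [m]; it makes the functional
   finite everywhere and [f] continuous. *)
have mKb m u : dirs x m -> `|u| <= r -> m (v0 + u) <= Kb.
  move=> /dirsA Am ur; have [ys] := hdom u ur; rewrite -addrA => Ay.
  have := monotone_le mA Ay Am; rewrite addrAC subrr add0r => h.
  rewrite (le_trans h)// (le_trans (dual_le _ _))// ler_pM//.
    by apply: (hbnd u) => //; rewrite -addrA.
  by rewrite (le_trans (ler_normD _ _))// lerD2l.
have gD (g : dual X) a b : g (a + b) = g a + g b by exact: linearD.
have gZ (g : dual X) s a : g (s *: a) = s * g a by exact: linearZ.
(* The epigraph announced at the start, with the cone element [c] written as [s v]. Convexity of [V]
   makes it additive and [dirs_ex] makes it nonnegative at [0]. *)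
pose E := [set dk : X * R | exists s v, [/\ 0 <= s, V v &
  forall m, dirs x m -> m dk.1 + s * m v - s * xs v <= dk.2]].
have [||d|f hf] := @hahn_banach_conic _ X E.
- split.
  + move=> d d' k k' [s [v [s0 Vv h]]] [s' [v' [s0' Vv' h']]].
    cbn [fst snd] in h, h'.
    have [ss0|ssN0] := eqVneq (s + s') 0.
      have s00 : s = 0 by apply/le_anti; rewrite s0 andbT -ss0 lerDl.
      have s00' : s' = 0 by rewrite -ss0 s00 add0r.
      exists 0, v; split => // m Mm; rewrite /= gD.
      by have := h m Mm; have := h' m Mm; rewrite s00 s00'; lra.
    have ssp : 0 < s + s' by rewrite lt_def ssN0 addr_ge0.
    exists (s + s'), ((s / (s + s')) *: v + (1 - s / (s + s')) *: v').
    split; first exact: addr_ge0.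
      apply: interior_op_dom_convex => //; first by rewrite divr_ge0// ltW.
      by rewrite ler_pdivrMr// mul1r lerDl.
    move=> m Mm; rewrite /= !gD !gZ.
    have e1 (a b : R) : (s + s') * (s / (s + s') * a + (1 - s / (s + s')) * b) =
      s * a + s' * b by field.
    by rewrite !e1; have := h m Mm; have := h' m Mm; lra.
  + move=> s d k s0 [s' [v [s0' Vv h]]]; cbn [fst snd] in h.
    exists (s * s'), v; split => //; first by rewrite mulr_ge0// ltW.
    move=> m Mm; rewrite /= gZ.
    have : s * (m d + s' * m v - s' * xs v) <= s * k by rewrite ler_pM2l// h.
    lra.
  + move=> k [s [v [s0 Vv h]]]; have [m Mm xm] := dirs_ex v Vv.
    have := h m Mm; rewrite /= linear0 add0r.
    have : s * xs v <= s * m v by rewrite ler_wpM2l.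
    lra.
- by exists 0, v0; split => // m _; rewrite /= linear0 !mul0r addr0 subr0.
(* So large that [s^-1 d] has norm at most [r] and [mKb] applies. *)
- pose s := (1 + `|d|) / r.
  have d1 : 0 < 1 + `|d| by rewrite ltr_pwDl.
  have s0 : 0 < s by rewrite divr_gt0.
  exists (s * Kb - s * xs v0), s, v0; split => //; first exact: ltW.
  move=> m Mm; rewrite /= lerD2r.
  have -> : m d + s * m v0 = s * m (v0 + s^-1 *: d).
    rewrite gD gZ mulrDr mulrA divff ?gt_eqF// mul1r; exact: addrC.
  rewrite ler_pM2l//; apply: mKb => //.
  rewrite normrZ gtr0_norm ?invr_gt0// /s invf_div mulrAC ler_pdivrMr//.
  by rewrite ler_pM2l// lerDr.
have fle d k : (forall m, dirs x m -> m d <= k) -> f d <= k.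
  move=> h; apply: hf; exists 0, v0; split => // m Mm /=.
  by rewrite !mul0r addr0 subr0 h.
have fge v : V v -> xs v <= f v.
  move=> Vv; rewrite -lerN2 -linearN; apply: hf; exists 1, v; split => // m Mm.
  have -> : m (- v) = - m v by exact: linearN.
  by rewrite /= !mul1r addNr sub0r.
have fr u : `|u| <= r -> f u <= Kb - f v0.
  move=> ur; rewrite lerBrDl -linearD; apply: fle => m Mm; exact: mKb.
have [a|g gE _] := @dual_of_bounded _ _ f ((Kb - f v0) / r).
  have [->|aN0] := eqVneq a 0; first by rewrite linear0 normr0 mulr0.
  have na : 0 < `|a| by rewrite normr_gt0.
  have nra : 0 < r / `|a| by rewrite divr_gt0.
  have := fr ((r / `|a|) *: a); rewrite normrZ gtr0_norm// divfK ?gt_eqF//.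
  have -> : f ((r / `|a|) *: a) = r / `|a| * f a by exact: linearZ.
  move=> /(_ (lexx _)) h; rewrite -(ler_pM2l nra) (le_trans h)//.
  by rewrite le_eqVlt; apply/orP; left; apply/eqP; field; rewrite !gt_eqF.
exists g.
  apply: closed_convex_hull_support => //.
    by have [m Mm _] := dirs_ex v0 Vv0; exists m.
  by move=> d k h; rewrite gE; exact: fle.
exists (xs - g); last by rewrite subrKC.
split; first by apply: subset_closure; exists xs.
apply: ge_ereal_sup => _ [y cy <-]; rewrite lee_fin.
have gB (h : dual X) a b : h (a - b) = h a - h b by exact: linearB.
(* Normality is tested on interior points only, which are dense in the closure of the domain. *)
rewrite gB subr_le0; apply: (@dual_closure_le _ _ (xs - g) (interior (op_dom A))).
  move=> {cy}y yi; rewrite -subr_le0 -gB dualB subr_le0 gE.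
  by apply: fge; exact: Vy.
exact: op_dom_sub_closure_interior.
Qed.

End decomposition.

Theorem corollary4p1 (R : realType) (X : completeNormedModType R)
    (A : X -> set (dual X)) (D : set X) (At : X -> dual X) :
  reflexive_space X ->
  maximal_monotone A ->
  interior (op_dom A) !=set0 ->
  dense_subset D (op_dom A) ->
  selection A At ->
  forall x : X,
    A x = set_add
      (closed_convex_hull
        (\bigcup_(v in [set y - x | y in interior (op_dom A)])
           wLimsup_dir At D x v))
      (normal_cone x (closure (op_dom A)))
    /\
    A x = set_add
      (closed_convex_hull (wLimsup At D x))
      (normal_cone x (closure (op_dom A))).
Proof.
move=> rX mmA intA DA sA x.
have addS (S T N : set (dual X)) : S `<=` T -> set_add S N `<=` set_add T N.
  by move=> ST _ [a Sa [b Nb <-]]; exists a; [exact: ST|exists b].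
have dirS : \bigcup_(v in [set y - x | y in interior (op_dom A)])
    wLimsup_dir At D x v `<=` wLimsup At D x.
  by move=> m [v _]; exact: wLimsup_dir_sub.
have hullA : closed_convex_hull (wLimsup At D x) `<=` A x.
  apply: closed_convex_hull_sub; [exact: maximal_monotone_closed|
    exact: maximal_monotone_convex|exact: wLimsup_sub].
have S1 := addS _ _ (normal_cone x (closure (op_dom A)))
  (closed_convex_hull_mono dirS).
have S2 := subset_trans (addS _ _ (normal_cone x (closure (op_dom A))) hullA)
  (@add_normal_cone _ _ _ mmA x).
have S0 : A x `<=` _ := @directional_decomposition _ _ _ _ _ rX mmA intA DA sA x.
(* The inclusions form a cycle through [A x] and the two right-hand sides, so all three sets
   coincide. *)
by split; apply/seteqP; split => //; [exact: subset_trans S2|exact: subset_trans S1].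
Qed.
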